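(* Let $\{(\hat s_i,\hat x_i)\}_{i=1}^N$ be a dataset with $\hat x_i\in\mathbb{X}(\hat s_i)$, let $\phi:\mathbb{S}\times\mathbb{X}\to\mathbb{R}^p$ be a feature mapping that is not trivially zero, and let $$\mathbb{C} := \big\{\theta\in\mathbb{R}^p : \langle\theta,\phi(\hat s_i,\hat x_i)-\phi(\hat s_i,x_i)\rangle\le 0,\ \forall x_i\in\mathbb{X}(\hat s_i),\ \forall i\in[N]\big\}$$ be the set of consistent cost vectors, with $\mathbb{C}\setminus\{0\}\neq\emptyset$. Then the incenter problem $$\theta^{\mathrm{in}} \in \operatorname*{argmax}_{\theta\neq 0}\ \min_{\substack{\tilde\theta\in\mathbb{R}^p\setminus\operatorname{int}(\mathbb{C})\\ \tilde\theta\neq 0}} a(\theta,\tilde\theta)$$ can be reformulated as $$\begin{aligned}(\theta^{\mathrm{in}},r^{\mathrm{in}})\in\operatorname*{argmax}_{\theta\in\mathbb{R}^p,\,r\in\mathbb{R}}\quad & r\\ \text{s.t.}\quad & \langle\theta,\phi(\hat s_i,\hat x_i)-\phi(\hat s_i,x_i)\rangle + r\,\|\phi(\hat s_i,x_i)-\phi(\hat s_i,\hat x_i)\|_2\le 0\quad\forall x_i\in\mathbb{X}(\hat s_i),\ \forall i\in[N]\\ & \|\theta\|_2=1,\end{aligned}$$ i.e., if $(\theta^{\mathrm{in}},r^{\mathrm{in}})$ is an optimal solution of this second problem, then $\theta^{\mathrm{in}}$ is a solution of the incenter problem.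
   Context: $\mathbb{S}$ is a set of signals; for each $s\in\mathbb{S}$, $\mathbb{X}(s)$ is the feasible set and $\mathbb{X}:=\bigcup_{s\in\mathbb{S}}\mathbb{X}(s)$. $[N]=\{1,\dots,N\}$. The feature mapping being ''not trivially zero'' means that $\phi(s,\cdot)$ is not identically zero on $\mathbb{X}(s)$ for the signals under consideration. For nonzero vectors, $a(\theta,\tilde\theta):=\arccos\big(\langle\theta,\tilde\theta\rangle/(\|\theta\|_2\|\tilde\theta\|_2)\big)$ is the Euclidean angle; $\operatorname{int}(\mathbb{C})$ is the interior of $\mathbb{C}$. *)

(* Defs.v *)
From HB Require Import structures.
From mathcomp Require Import all_boot all_order all_algebra.
From mathcomp Require Import all_classical all_reals all_analysis.

Set Implicit Arguments.
Unset Strict Implicit.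
Unset Printing Implicit Defensive.

Import Order.TTheory GRing.Theory Num.Theory.
Import numFieldNormedType.Exports.

Local Open Scope classical_set_scope.
Local Open Scope ring_scope.

(* The library norm on 'rV[R]_p is the sup norm, so the Euclidean inner product
   and norm are defined here; the library topology is the usual one of R^p. *)
Definition dotv (R : realType) (p : nat) (u v : 'rV[R]_p) : R :=
  \sum_(j < p) u 0 j * v 0 j.

Definition norm2 (R : realType) (p : nat) (u : 'rV[R]_p) : R :=
  Num.sqrt (dotv u u).

Definition angle (R : realType) (p : nat) (u v : 'rV[R]_p) : R :=
  acos (dotv u v / (norm2 u * norm2 v)).

Definition is_min (R : realType) (A : set R) (m : R) : Prop :=
  A m /\ lbound A m.

Definition argmax (R : realType) (T : Type) (D : set T) (f : T -> R) : set T :=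
  [set x | D x /\ forall y, D y -> f y <= f x].

Section InverseOptimization.

(* U is an ambient type for the feasible points: X s : set U, and the union of
   the sets X s is the set on which phi s is meant to be defined. *)
Context (R : realType) (S U : Type) (p N : nat).
Context (X : S -> set U) (phi : S -> U -> 'rV[R]_p).
Context (hs : 'I_N -> S) (hx : 'I_N -> U).

Definition not_trivially_zero : Prop :=
  forall i : 'I_N, exists2 x, X (hs i) x & phi (hs i) x != 0.

Definition consistent_set : set 'rV[R]_p :=
  [set theta | forall (i : 'I_N) (x : U), X (hs i) x ->
    dotv theta (phi (hs i) (hx i) - phi (hs i) x) <= 0].

Definition reformulation_feasible : set ('rV[R]_p * R) :=
  [set z | (forall (i : 'I_N) (x : U), X (hs i) x ->
      dotv z.1 (phi (hs i) (hx i) - phi (hs i) x)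
      + z.2 * norm2 (phi (hs i) x - phi (hs i) (hx i)) <= 0)
    /\ norm2 z.1 = 1].

Definition reformulation_solutions : set ('rV[R]_p * R) :=
  argmax reformulation_feasible (fun z => z.2).

End InverseOptimization.

Definition angles_to_exterior (R : realType) (p : nat) (C : set 'rV[R]_p)
    (theta : 'rV[R]_p) : set R :=
  [set angle theta t | t in [set t | ~ interior C t /\ t != 0]].

(* The inner minimum is a genuine (attained) minimum: being a solution includes
   that the objective f is well defined at every nonzero vector. *)
Definition incenter_solutions (R : realType) (p : nat) (C : set 'rV[R]_p) :
    set 'rV[R]_p :=
  [set theta | exists2 f : 'rV[R]_p -> R,
    (forall t, t != 0 -> is_min (angles_to_exterior C t) (f t)) &
    argmax [set t | t != 0] f theta].

(* Main.v *)
Require Import Defs.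
From HB Require Import structures.
From mathcomp Require Import all_boot all_order all_algebra.
From mathcomp Require Import all_classical all_reals all_analysis.
From mathcomp Require Import ring lra.

Import Order.TTheory GRing.Theory Num.Theory.
Import numFieldNormedType.Exports.

Local Open Scope classical_set_scope.
Local Open Scope ring_scope.

(** Write C as the polar cone of the set D of the differences
    d = phi (hs i) (hx i) - phi (hs i) x. A unit vector theta is feasible for
    the reformulation with value r when it has margin r, that is, when its
    distance to each hyperplane d^perp with d nonzero, counted positively on the
    side of C, is at least r. The distance from theta to d^perp is the sine of
    the angle between them, so for theta in C the largest margin is the sine of
    the smallest angle between theta and the exterior of C, as long as that
    angle is at most pi/2. Two facts make this precise and suffice for the
    theorem:

    - if theta has margin r, with 0 <= r <= 1, then the circular cone of axis
      theta and half-angle arcsin r lies in C, so an exterior vector makes with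
      theta an angle of cosine at most sqrt (1 - r^2) ([exterior_dotv_le]);
    - if every exterior vector makes with theta an angle of cosine at most c,
      with 0 <= c < 1, then theta has margin sqrt (1 - c^2)
      ([has_margin_of_cosine]): the projection of theta on d^perp, when it is
      nonzero, is exterior, and it realizes the distance to d^perp.

    Let theta have the optimal margin r, and let c be the largest cosine between
    a competitor tau and an exterior vector; it is attained, by compactness of
    the sphere ([max_exterior_cosine]). If 0 <= c < 1, the second fact and
    optimality give sqrt (1 - c^2) <= r, and the first one then bounds the
    cosines of theta by sqrt (1 - r^2) <= c. If c = 1 there is nothing to prove.
    If c < 0, then the space is a line, because a nonzero vector orthogonal to d
    and its opposite are both exterior, and normalizing tau gives the same unit
    vector as theta. This is [exterior_cosine_le]; the arccosine, being
    decreasing, turns it into the maximality of the smallest angle. *)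

(** * Euclidean geometry of row vectors *)

Section Euclidean.
Context {R : realType} {p : nat}.
Implicit Types (u v w : 'rV[R]_p) (k : R).

Lemma dotvC u v : dotv u v = dotv v u.
Proof. by apply: eq_bigr => j _; rewrite mulrC. Qed.

Lemma dotvDl u v w : dotv (u + v) w = dotv u w + dotv v w.
Proof. by rewrite -big_split; apply: eq_bigr => j _; rewrite mxE mulrDl. Qed.

Lemma dotvZl k u v : dotv (k *: u) v = k * dotv u v.
Proof. by rewrite /dotv mulr_sumr; apply: eq_bigr => j _; rewrite mxE mulrA. Qed.

Lemma dotvDr u v w : dotv u (v + w) = dotv u v + dotv u w.
Proof. by rewrite dotvC dotvDl !(dotvC _ u). Qed.

Lemma dotvZr k u v : dotv u (k *: v) = k * dotv u v.
Proof. by rewrite dotvC dotvZl dotvC. Qed.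

Lemma dotv0 u : dotv u 0 = 0.
Proof. by rewrite -(scale0r 0) dotvZr mul0r. Qed.

Lemma dotvBl u v w : dotv (u - v) w = dotv u w - dotv v w.
Proof. by rewrite -scaleN1r dotvDl dotvZl mulN1r. Qed.

Lemma dotvBr u v w : dotv u (v - w) = dotv u v - dotv u w.
Proof. by rewrite dotvC dotvBl !(dotvC _ u). Qed.

Lemma dotvv_ge0 u : 0 <= dotv u u.
Proof. by apply: sumr_ge0 => j _; rewrite -expr2 sqr_ge0. Qed.

Lemma dotvv_eq0 u : dotv u u = 0 -> u = 0.
Proof.
move=> u0; apply/rowP => j; rewrite mxE; apply/eqP.
rewrite -sqrf_eq0 expr2; apply/eqP; move: j isT.
by apply/psumr_eq0P => // j _; rewrite -expr2 sqr_ge0.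
Qed.

Lemma norm2_ge0 u : 0 <= norm2 u. Proof. exact: sqrtr_ge0. Qed.

Lemma norm2_sqr u : norm2 u ^+ 2 = dotv u u.
Proof. by rewrite sqr_sqrtr // dotvv_ge0. Qed.

Lemma norm2_gt0 u : u != 0 -> 0 < norm2 u.
Proof.
move=> u0; rewrite sqrtr_gt0 lt_neqAle dotvv_ge0 andbT eq_sym.
by apply: contra u0 => /eqP/dotvv_eq0 ->.
Qed.

Lemma norm2_neq0 u : 0 < norm2 u -> u != 0.
Proof. by apply: contraTneq => ->; rewrite /norm2 dotv0 sqrtr0 ltxx. Qed.

Lemma norm2Z k u : norm2 (k *: u) = `|k| * norm2 u.
Proof.
by rewrite /norm2 dotvZl dotvZr mulrA -expr2 sqrtrM ?sqr_ge0 // sqrtr_sqr.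
Qed.

Lemma norm2B u v : norm2 (u - v) = norm2 (v - u).
Proof. by rewrite -opprB -scaleN1r norm2Z normrN1 mul1r. Qed.

Lemma norm2_normalize u : u != 0 -> norm2 ((norm2 u)^-1 *: u) = 1.
Proof.
move=> /norm2_gt0 u0.
by rewrite norm2Z ger0_norm ?invr_ge0 ?norm2_ge0 // mulVf // gt_eqF.
Qed.

Lemma cauchy_schwarz u v : `|dotv u v| <= norm2 u * norm2 v.
Proof.
have [->|v0] := eqVneq v 0; first by rewrite dotv0 normr0 mulr_ge0 ?norm2_ge0.
have vv : 0 < dotv v v by rewrite -norm2_sqr exprn_gt0 // norm2_gt0.
rewrite -ler_sqr ?nnegrE ?mulr_ge0 ?norm2_ge0 // real_normK ?num_real //.
rewrite exprMn !norm2_sqr -subr_ge0 -(pmulr_rge0 _ vv).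
have := dotvv_ge0 (dotv v v *: u - dotv u v *: v).
rewrite !(dotvBl, dotvBr, dotvZl, dotvZr) (dotvC v u).
by congr (0 <= _); ring.
Qed.

Definition cosine u v := dotv u v / (norm2 u * norm2 v).

Lemma cosine_itv u v : -1 <= cosine u v <= 1.
Proof.
rewrite -ler_norml normrM normfV (ger0_norm (mulr_ge0 _ _)) ?norm2_ge0 //.
have := mulr_ge0 (norm2_ge0 u) (norm2_ge0 v); rewrite le_eqVlt.
case/predU1P => [<-|uv]; first by rewrite invr0 mulr0.
by rewrite ler_pdivrMr // mul1r cauchy_schwarz.
Qed.

Lemma cosine_normalizel u v : u != 0 ->
  cosine ((norm2 u)^-1 *: u) v = cosine u v.
Proof.
by move=> u0; rewrite /cosine norm2_normalize // dotvZl mul1r invfM; ring.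
Qed.

Lemma cosine_normalizer u v : v != 0 ->
  cosine u ((norm2 v)^-1 *: v) = cosine u v.
Proof.
by move=> v0; rewrite /cosine norm2_normalize // dotvZr mulr1 invfM; ring.
Qed.

Lemma cosine_le u v c : norm2 u = 1 -> v != 0 ->
  (cosine u v <= c) = (dotv u v <= c * norm2 v).
Proof. by move=> u1 v0; rewrite /cosine u1 mul1r ler_pdivrMr // norm2_gt0. Qed.

Lemma acos_le (x y : R) : -1 <= x <= 1 -> -1 <= y <= 1 ->
  (acos x <= acos y) = (y <= x).
Proof.
move=> x1 y1; have ac z : -1 <= z <= 1 -> (acos z : R) \in `[0, pi].
  by move=> z1; rewrite in_itv /= acos_ge0 // acos_lepi.
by rewrite leNgt -ltr_cos ?ac // !acosK ?in_itv //= -leNgt.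
Qed.

Lemma dotv_continuous u : continuous (dotv u).
Proof.
apply: (continuous_big (op := +%R)); first exact: add_continuous.
move=> j _ v; apply: continuousM; first exact: cst_continuous.
exact: coord_continuous.
Qed.

Lemma norm2_continuous : continuous (@norm2 R p).
Proof.
have sqc : continuous (fun w : 'rV[R]_p => dotv w w).
  apply: (continuous_big (op := +%R)); first exact: add_continuous.
  by move=> j _ v; apply: continuousM; exact: coord_continuous.
by move=> v; apply: (continuous_comp (sqc v)); exact: sqrt_continuous.
Qed.

Lemma compact_sphere : compact [set v : 'rV[R]_p | norm2 v = 1].
Proof.
apply: bounded_closed_compact.
  exists 1; split => // b b1 v /= v1; apply: (le_trans _ (ltW b1)).
  rewrite /Num.norm /= mx_normrE; apply: bigmax_le => // -[i j] _ /=.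
  rewrite ord1 -ler_sqr ?nnegrE // real_normK ?num_real // -v1 norm2_sqr.
  rewrite /dotv (bigD1 j) //= -expr2 lerDl.
  by apply: sumr_ge0 => l _; rewrite -expr2 sqr_ge0.
apply: (preimage_closed (f := @norm2 R p) _ (closed_eq (y := 1))).
by move=> v _; exact: norm2_continuous.
Qed.

(** The left-hand side is the inner product of the components of [v] and [w]
    orthogonal to [u], and the square roots are the lengths of these components;
    this is the Cauchy-Schwarz inequality in the orthogonal complement of [u]. *)
Lemma dotv_le_residual u v w : norm2 u = 1 ->
  dotv v w - dotv u v * dotv u w <=
  Num.sqrt (norm2 v ^+ 2 - dotv u v ^+ 2)
  * Num.sqrt (norm2 w ^+ 2 - dotv u w ^+ 2).
Proof.
move=> u1; have uu : dotv u u = 1 by rewrite -norm2_sqr u1 expr1n.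
have res z t : dotv (z - dotv u z *: u) (t - dotv u t *: u) =
    dotv z t - dotv u z * dotv u t.
  by rewrite !(dotvBl, dotvBr, dotvZl, dotvZr) uu (dotvC z u); ring.
rewrite -res !norm2_sqr !expr2 -!res.
exact: le_trans (ler_norm _) (cauchy_schwarz _ _).
Qed.

(** The hypothesis on [d] says that the space is a line, and a line has only two
    unit vectors. *)
Lemma unit_antiparallel u d : (forall v, dotv v d = 0 -> v = 0) ->
  d != 0 -> norm2 u = 1 -> dotv u d <= 0 -> u = - (norm2 d)^-1 *: d.
Proof.
move=> orth0 d0 u1 ud; have nd := norm2_gt0 d d0.
pose a := dotv u d / norm2 d ^+ 2.
have /orth0/eqP : dotv (u - a *: d) d = 0.
  by rewrite dotvBl dotvZl -norm2_sqr mulfVK ?subrr // expf_neq0 // gt_eqF.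
rewrite subr_eq0 => /eqP uE.
have a0 : a <= 0 by rewrite pmulr_lle0 // invr_gt0 exprn_gt0.
move: u1; rewrite {1}uE norm2Z ler0_norm // => an.
rewrite {1}uE; congr (_ *: _); apply: (mulIf (lt0r_neq0 nd)).
by rewrite mulNr mulVf ?gt_eqF //; lra.
Qed.

End Euclidean.

(** * Margins and angles to the exterior of a polar cone *)

Section PolarCone.
Context {R : realType} {p : nat} (D : set 'rV[R]_p).
Implicit Types (u v d theta : 'rV[R]_p) (r c : R).

Definition polar_cone : set 'rV[R]_p :=
  [set theta | forall d, D d -> dotv theta d <= 0].

Definition has_margin theta r : Prop :=
  forall d, D d -> dotv theta d + r * norm2 d <= 0.

Definition exterior v : Prop := ~ interior polar_cone v /\ v != 0.

Lemma exterior_normalize v : exterior v -> exterior ((norm2 v)^-1 *: v).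
Proof.
case=> vC v0; have n0 := norm2_gt0 v v0; split; last first.
  by rewrite scaler_eq0 negb_or v0 invr_eq0 gt_eqF.
apply: contra_not vC => vC.
have near_v : nbhs v (fun w => polar_cone ((norm2 v)^-1 *: w)).
  exact: (@scaler_continuous _ _ (norm2 v)^-1 v _ vC).
rewrite /interior /=; apply: filterS near_v => w wC d /wC.
by rewrite dotvZl pmulr_rle0 // invr_gt0.
Qed.

(** Moving [v] slightly in the direction [d] violates the constraint of [d]. *)
Lemma exterior_halfspace d v :
  D d -> d != 0 -> v != 0 -> 0 <= dotv v d -> exterior v.
Proof.
move=> Dd d0 v0 vd; split=> // vC.
have cv : v + e *: d @[e --> (0 : R)^'+] --> v.
  apply: cvg_at_right_filter.
  rewrite -[X in _ --> X]addr0 -[in X in _ --> X](scale0r d).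
  by apply: cvgD; [exact: cvg_cst|exact: scalel_continuous].
have [e [e0 /(_ d Dd)]] : exists e : R, 0 < e /\ polar_cone (v + e *: d).
  have : \forall e \near (0 : R)^'+, 0 < e /\ polar_cone (v + e *: d).
    near=> e; split; first by near: e; exact: nbhs_right_gt.
    by near: e; exact: (cv _ vC).
  by move/filter_ex.
rewrite dotvDl dotvZl -norm2_sqr.
have : 0 < e * norm2 d ^+ 2 by rewrite mulr_gt0 // exprn_gt0 // norm2_gt0.
by lra.
Unshelve. all: by end_near. Qed.

Lemma margin_le1 theta r d :
  norm2 theta = 1 -> has_margin theta r -> D d -> d != 0 -> r <= 1.
Proof.
move=> th1 mr Dd d0; rewrite -(ler_pM2r (norm2_gt0 d d0)) mul1r.
have := cauchy_schwarz theta d; rewrite th1 mul1r => /ler_normlP[].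
by have := mr d Dd; lra.
Qed.

(** Split [v] and [d] along [theta]: the components along [theta] contribute at
    most [- s * r] times the product of the lengths of [v] and [d], where
    [s = Num.sqrt (1 - r ^+ 2)], and the orthogonal components, of lengths at
    most [r * norm2 v] and [s * norm2 d], contribute at most the opposite. *)
Lemma cap_sub_polar_cone theta r v :
  norm2 theta = 1 -> 0 <= r <= 1 -> has_margin theta r ->
  Num.sqrt (1 - r ^+ 2) * norm2 v <= dotv theta v -> polar_cone v.
Proof.
move=> th1 /andP[r0 r1] mr; set s := Num.sqrt _ => sv d Dd.
have s0 : 0 <= s := sqrtr_ge0 _.
have s2 : s ^+ 2 = 1 - r ^+ 2 by rewrite sqr_sqrtr // subr_ge0 expr_le1.
have [v0 d0] := (norm2_ge0 v, norm2_ge0 d).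
have rd : r * norm2 d <= - dotv theta d by have := mr d Dd; lra.
have sqx : (s * norm2 v) ^+ 2 <= dotv theta v ^+ 2.
  rewrite lerXn2r ?nnegrE ?mulr_ge0 //.
  by apply: le_trans sv; exact: mulr_ge0.
have sqy : (r * norm2 d) ^+ 2 <= dotv theta d ^+ 2.
  rewrite -[leRHS]sqrrN lerXn2r ?nnegrE ?mulr_ge0 //.
  by apply: le_trans rd; exact: mulr_ge0.
have resv : Num.sqrt (norm2 v ^+ 2 - dotv theta v ^+ 2) <= r * norm2 v.
  rewrite -[leRHS]ger0_norm ?mulr_ge0 // -sqrtr_sqr ler_wsqrtr //.
  by move: sqx; rewrite !exprMn s2; lra.
have resd : Num.sqrt (norm2 d ^+ 2 - dotv theta d ^+ 2) <= s * norm2 d.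
  rewrite -[leRHS]ger0_norm ?mulr_ge0 // -sqrtr_sqr ler_wsqrtr //.
  by move: sqy; rewrite !exprMn s2; lra.
have := dotv_le_residual theta v d th1.
have := ler_pM (sqrtr_ge0 _) (sqrtr_ge0 _) resv resd.
have := ler_pM (mulr_ge0 s0 v0) (mulr_ge0 r0 d0) sv rd.
lra.
Qed.

(** The opposite strict inequality would persist near [v], which would then be
    interior by [cap_sub_polar_cone]. *)
Lemma exterior_dotv_le theta r v :
  norm2 theta = 1 -> 0 <= r <= 1 -> has_margin theta r -> exterior v ->
  dotv theta v <= Num.sqrt (1 - r ^+ 2) * norm2 v.
Proof.
move=> th1 r01 mr [+ _]; rewrite leNgt => vC; apply/negP => sv; apply: vC.
pose g w := dotv theta w - Num.sqrt (1 - r ^+ 2) * norm2 w.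
have gc : g w @[w --> v] --> g v.
  apply: continuousB; first exact: dotv_continuous.
  by apply: continuousM; [exact: cst_continuous|exact: norm2_continuous].
have g0 : 0 < g v by rewrite subr_gt0.
have near_v : \forall w \near v, 0 < g w by exact: (cvgr_gt _ gc _ g0).
rewrite /interior /=; apply: filterS near_v => w gw.
by apply: cap_sub_polar_cone mr _ => //; rewrite -subr_ge0 ltW.
Qed.

(** With [a] the cosine of the angle from [theta] to [d], the projection [t] of
    [theta] on the hyperplane orthogonal to [d] is exterior unless it is zero,
    and makes with [theta] an angle of cosine [Num.sqrt (1 - a ^+ 2)]. The bound
    [c < 1] forces [theta] itself not to be exterior, hence [a < 0]. *)
Lemma has_margin_of_cosine theta c :
  norm2 theta = 1 -> 0 <= c < 1 ->
  (forall v, exterior v -> cosine theta v <= c) ->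
  has_margin theta (Num.sqrt (1 - c ^+ 2)).
Proof.
move=> th1 /andP[c0 c1] hc d Dd.
have [->|d0] := eqVneq d 0.
  by rewrite dotv0 /norm2 dotv0 sqrtr0 mulr0 addr0.
have th0 : theta != 0 by apply: norm2_neq0; rewrite th1.
have nd := norm2_gt0 d d0.
have tt : dotv theta theta = 1 by rewrite -norm2_sqr th1 expr1n.
have td : dotv theta d < 0.
  rewrite ltNge; apply/negP => td.
  have /hc := exterior_halfspace _ _ Dd d0 th0 td.
  by rewrite cosine_le // tt th1 mulr1; lra.
pose a := dotv theta d / norm2 d.
pose t := theta - (a / norm2 d) *: d.
have ad : dotv theta d = a * norm2 d by rewrite mulfVK // gt_eqF.
have a0 : a < 0 by rewrite -(pmulr_llt0 _ nd) -ad.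
have tE : dotv theta t = 1 - a ^+ 2.
  by rewrite dotvBr dotvZr tt ad; field; rewrite gt_eqF.
have dt : dotv t d = 0.
  by rewrite dotvBl dotvZl ad -norm2_sqr; field; rewrite gt_eqF.
have tt2 : norm2 t ^+ 2 = 1 - a ^+ 2.
  by rewrite norm2_sqr {2}/t dotvBr dotvZr dt mulr0 subr0 dotvC.
suff : Num.sqrt (1 - c ^+ 2) <= - a.
  by rewrite -(ler_pM2r nd) ad; lra.
have na0 : 0 <= - a by rewrite oppr_ge0 ltW.
rewrite -[leRHS]ger0_norm // -sqrtr_sqr ler_wsqrtr // sqrrN.
suff : norm2 t ^+ 2 <= c ^+ 2 by rewrite tt2; lra.
rewrite lerXn2r ?nnegrE ?norm2_ge0 //.
(* t = 0 happens when theta is a negative multiple of d. *)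
have [->|t0] := eqVneq t 0; first by rewrite /norm2 dotv0 sqrtr0.
have /hc : exterior t by apply: exterior_halfspace Dd d0 t0 _; rewrite dt.
by rewrite cosine_le // tE -tt2 expr2 ler_pM2r // norm2_gt0.
Qed.

(** The comparison behind the theorem: the exterior is at least as far, in
    angle, from the vector [theta] of largest margin as from any other one. *)
Lemma exterior_cosine_le theta r tau c d :
  norm2 theta = 1 -> 0 <= r -> has_margin theta r ->
  (forall u s, norm2 u = 1 -> has_margin u s -> s <= r) ->
  D d -> d != 0 -> norm2 tau = 1 ->
  (forall v, exterior v -> cosine tau v <= c) ->
  forall v, exterior v -> cosine theta v <= c.
Proof.
move=> th1 r0 mr rmax Dd d0 tau1 hc v ve.
have [c1|c1] := lerP 1 c.
  by apply: le_trans c1; have /andP[] := cosine_itv theta v.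
have r1 := margin_le1 _ _ _ th1 mr Dd d0.
have [c0|c0] := lerP 0 c.
  have sr : Num.sqrt (1 - c ^+ 2) <= r.
    by apply: (rmax tau) => //; apply: has_margin_of_cosine => //; rewrite c0.
  rewrite cosine_le //; last by case: ve.
  apply: (le_trans (exterior_dotv_le _ r _ th1 _ mr ve)); first by rewrite r0.
  rewrite ler_wpM2r ?norm2_ge0 //.
  rewrite -[leRHS]ger0_norm // -sqrtr_sqr ler_wsqrtr //.
  have : Num.sqrt (1 - c ^+ 2) ^+ 2 <= r ^+ 2.
    by rewrite lerXn2r ?nnegrE ?sqrtr_ge0.
  by rewrite sqr_sqrtr ?subr_ge0 ?expr_le1 ?(ltW c1) //; lra.
(* c < 0: every exterior vector makes an obtuse angle with tau, but both u and
   - u are exterior when u is a nonzero vector orthogonal to d. *)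
have neg u : exterior u -> dotv tau u < 0.
  move=> ue; have := hc u ue; rewrite cosine_le //; last by case: ue.
  by move=> /le_lt_trans; apply; rewrite pmulr_llt0 // norm2_gt0 //; case: ue.
have negd u : dotv u d = 0 -> u != 0 -> dotv tau u < 0.
  by move=> ud u0; apply/neg/(exterior_halfspace _ _ Dd d0 u0); rewrite ud.
have orth0 u : dotv u d = 0 -> u = 0.
  move=> ud; apply/eqP; apply: contraT => u0.
  have p1 := negd u ud u0.
  have : dotv tau (- u) < 0.
    by apply: negd; rewrite ?oppr_eq0 // -scaleN1r dotvZl ud mulr0.
  by rewrite -scaleN1r dotvZr; lra.
have td : dotv theta d <= 0.
  by have := mr d Dd; have := mulr_ge0 r0 (norm2_ge0 d); lra.
have taud : dotv tau d <= 0.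
  exact/ltW/neg/(exterior_halfspace _ _ Dd d0 d0)/dotvv_ge0.
have -> : theta = tau; last exact: hc.
by rewrite (unit_antiparallel theta d) // (unit_antiparallel tau d).
Qed.

(** The cosine depends only on the direction of [v], so it is enough to maximize
    the linear form [dotv theta] over the exterior part of the unit sphere. *)
Lemma max_exterior_cosine theta d : D d -> d != 0 -> theta != 0 ->
  exists2 v, exterior v &
    forall w, exterior w -> cosine theta w <= cosine theta v.
Proof.
move=> Dd d0 th0.
pose E := [set v : 'rV[R]_p | norm2 v = 1] `&` ~` interior polar_cone.
have E1 u : exterior u -> E ((norm2 u)^-1 *: u).
  move=> ue; split; last by case: (exterior_normalize _ ue).
  by apply: norm2_normalize; case: ue.
have cE : compact E.
  apply: compact_closedI; first exact: compact_sphere.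
  exact/open_closedC/open_interior.
have E0 : E !=set0.
  exists ((norm2 d)^-1 *: d).
  exact/E1/(exterior_halfspace _ _ Dd d0 d0)/dotvv_ge0.
have ctn : {within E, continuous (dotv theta)}.
  exact/continuous_subspaceT/dotv_continuous.
have [v /set_mem[v1 vC] vmax] := compact_EVT_max E0 cE ctn.
have v0 : v != 0 by apply: norm2_neq0; rewrite v1.
exists v => // w we; have w0 : w != 0 by case: we.
rewrite -(cosine_normalizer theta w) //.
have := vmax _ (mem_set (E1 _ we)).
rewrite /cosine norm2_normalize // v1 mulr1.
by rewrite ler_pM2r // invr_gt0 norm2_gt0.
Qed.

End PolarCone.

(** * The incenter *)

Theorem theorem3p5 (R : realType) (S U : Type) (p N : nat)
  (X : S -> set U) (phi : S -> U -> 'rV[R]_p)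
  (hs : 'I_N -> S) (hx : 'I_N -> U)
  (hx_feasible : forall i : 'I_N, X (hs i) (hx i))
  (phi_nontrivial : not_trivially_zero X phi hs)
  (C_nontrivial : consistent_set X phi hs hx `\ 0 !=set0)
  (theta_in : 'rV[R]_p) (r_in : R) :
  reformulation_solutions X phi hs hx (theta_in, r_in) ->
  incenter_solutions (consistent_set X phi hs hx) theta_in.
Proof.
move=> [[mfeas /= th1] opt].
pose D := [set d | exists i x,
  X (hs i) x /\ d = phi (hs i) (hx i) - phi (hs i) x].
have CE : consistent_set X phi hs hx = polar_cone D.
  apply/seteqP; split=> [t tC _ [i [x [Xx ->]]]|t tC i x Xx]; first exact: tC.
  by apply: tC; exists i, x.
have feasP t s : norm2 t = 1 -> has_margin D t s -> s <= r_in.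
  move=> t1 ts; apply: (opt (t, s)); split=> //= i x Xx.
  by rewrite norm2B; apply: ts; exists i, x.
have mr : has_margin D theta_in r_in.
  by move=> _ [i [x [Xx ->]]]; rewrite norm2B; exact: mfeas.
have r0 : 0 <= r_in.
  (* A normalized nonzero element of C has margin 0. *)
  have [t [tC /eqP t0]] := C_nontrivial.
  apply: (feasP ((norm2 t)^-1 *: t)); first exact: norm2_normalize.
  move=> d Dd; rewrite mul0r addr0 dotvZl pmulr_rle0 ?invr_gt0 ?norm2_gt0 //.
  by move: tC; rewrite CE; apply.
(* If every d in D were 0, the margin would be unbounded. *)
have [d Dd d0] : exists2 d, D d & d != 0.
  apply: contrapT => noD.
  suff : r_in + 1 <= r_in by lra.
  apply: (feasP theta_in) => // d Dd.
  have [->|d0] := eqVneq d 0.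
    by rewrite dotv0 /norm2 dotv0 sqrtr0 mulr0 addr0.
  by exfalso; apply: noD; exists d.
have ex t : exists v, t != 0 ->
    exterior D v /\ forall w, exterior D w -> cosine t w <= cosine t v.
  have [->|t0] := eqVneq t 0; first by exists 0.
  by have [v ve vm] := max_exterior_cosine D t d Dd d0 t0; exists v.
have [g gP] := choice ex.
exists (fun t => angle t (g t)) => [t t0|].
  have [ge gm] := gP t t0; rewrite CE; split; first by exists (g t).
  move=> _ [w we <-]; rewrite acos_le; first exact: gm.
    exact: cosine_itv.
  exact: cosine_itv.
have th0 : theta_in != 0 by apply: norm2_neq0; rewrite th1.
split=> // t t0; rewrite /angle acos_le; try exact: cosine_itv.
have [_ gm] := gP t t0.
apply: (exterior_cosine_le D theta_in r_in ((norm2 t)^-1 *: t) _ d) => //.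
- exact: norm2_normalize.
- by move=> v /gm; rewrite cosine_normalizel.
- by have [] := gP _ th0.
Qed.
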